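(* For a nonnegative integer $k$ let $\mathrm{Magog}_n(k~\mathrm{inv})$ (resp. $\mathrm{Magog}_n(k~\mathrm{posinv})$) be the set of $n\times n$ magog matrices $A$ with $\mathrm{inv}(A)=k$ (resp. $\mathrm{posinv}(A)=k$). Then: (1) for all $n\ge1$, $|\mathrm{Magog}_n(0~\mathrm{inv})|=|\mathrm{Magog}_n(0~\mathrm{posinv})|=1$; (2) for all $n\ge2$, $|\mathrm{Magog}_n(1~\mathrm{inv})|=1$; (3) for all $n\ge2$, $|\mathrm{Magog}_n(\binom{n}{2}-1~\mathrm{posinv})|=n-1$; (4) for all $n\ge2$, $|\mathrm{Magog}_n(\binom{n}{2}~\mathrm{inv})|=|\mathrm{Magog}_n(\binom{n}{2}~\mathrm{posinv})|=1$; (5) for all $n\ge3$, $|\mathrm{Magog}_n(2~\mathrm{inv})|=n+1$.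
   Context: An $n\times n$ magog matrix is an $n\times n$ matrix $A=(a_{ij})$ with entries in $\{0,1,-1\}$ such that all row sums and all column sums equal $1$, $0\le \sum_{i'=1}^{i}a_{i'j}\le 1$ for all $1\le i,j\le n$, $\sum_{j'=1}^{j}a_{ij'}\ge 0$ for all $1\le i,j\le n$, and for all $1\le i\le n-2$, $1\le j\le n-2$, $$\sum_{j'=1}^{j}a_{i+1,j'}+\sum_{i'=1}^{i+1}a_{i',j+1}-\sum_{i'=1}^{i}a_{i'j}\ge 0.$$ The inversion number is $\mathrm{inv}(A)=\sum_{1\le k<i\le n}\sum_{1\le j<l\le n}a_{ij}a_{kl}$, and the positive inversion number is $\mathrm{posinv}(A)=\mathrm{inv}(A)-\mathcal{N}(A)$, where $\mathcal{N}(A)$ is the number of entries of $A$ equal to $-1$. *)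

(* Defs.v *)
From mathcomp Require Import all_boot all_order all_algebra.

Set Implicit Arguments.
Unset Strict Implicit.
Unset Printing Implicit Defensive.

Import Order.TTheory GRing.Theory Num.Theory.
Local Open Scope ring_scope.

(* Indices are ordinals, so position i here is position i + 1 in the usual
   1-based numbering, and partial sums include the bounding index. *)

Definition row_psum (n : nat) (A : 'M[int]_n) (i j : 'I_n) : int :=
  \sum_(j' < n | (j' <= j)%N) A i j'.

Definition col_psum (n : nat) (A : 'M[int]_n) (i j : 'I_n) : int :=
  \sum_(i' < n | (i' <= i)%N) A i' j.

(* In the last clause i1 and j1 are the successors of i and j; the 1-based
   bounds i, j <= n - 2 read i + 2 < n and j + 2 < n on 0-based indices. *)
Definition is_magog (n : nat) (A : 'M[int]_n) : bool :=
  [&& [forall i, forall j, A i j \in [:: 0; 1; -1]],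
      [forall i, \sum_(j < n) A i j == 1],
      [forall j, \sum_(i < n) A i j == 1],
      [forall i, forall j, 0 <= col_psum A i j <= 1],
      [forall i, forall j, 0 <= row_psum A i j]
    & [forall i : 'I_n, forall i1 : 'I_n, forall j : 'I_n, forall j1 : 'I_n,
        [&& i1 == i.+1 :> nat, j1 == j.+1 :> nat, (i.+2 < n)%N
          & (j.+2 < n)%N] ==>
        (0 <= row_psum A i1 j + col_psum A i1 j1 - col_psum A i j)]].

Definition inv_num (n : nat) (A : 'M[int]_n) : int :=
  \sum_(i < n) \sum_(k < n | (k < i)%N)
    \sum_(j < n) \sum_(l < n | (j < l)%N) A i j * A k l.

Definition num_neg1 (n : nat) (A : 'M[int]_n) : nat :=
  #|[set p : 'I_n * 'I_n | A p.1 p.2 == -1]|.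

Definition posinv_num (n : nat) (A : 'M[int]_n) : int :=
  inv_num A - (num_neg1 A)%:Z.

(* Matrices over the three-element type {0, 1, -1} form a finType, so sets of
   magog matrices are finite sets; int_mx recovers the integer matrix and is
   injective with image the integer matrices with entries 0, 1, -1. *)
Definition sign_entry : Type := seq_sub [:: 0; 1; -1 : int].

Definition int_mx (n : nat) (A : 'M[sign_entry]_n) : 'M[int]_n :=
  map_mx val A.

Definition Magog_inv (n k : nat) : {set 'M[sign_entry]_n} :=
  [set A : 'M[sign_entry]_n
     | is_magog (int_mx A) & inv_num (int_mx A) == k%:Z].

Definition Magog_posinv (n k : nat) : {set 'M[sign_entry]_n} :=
  [set A : 'M[sign_entry]_n
     | is_magog (int_mx A) & posinv_num (int_mx A) == k%:Z].

(* Main.v *)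
(* The partial column sums of a magog matrix are 0/1, so the first i rows are
   recorded by the i-element set S_i of columns with partial sum 1.  Put
   h(i,j) = |S_i /\ [0,j)|.  Then inv is the sum, over i and over j in S_i, of
   the nonnegative numbers h(i+1,j) - h(i,j), and posinv is the same sum with
   j+1 in place of j.

   Few inversions: if S_q <> [0,q) then inv >= q.  Indeed S_k <> [0,k) for all
   1 <= k <= q by the magog condition, and each lengthening of the initial
   segment contained in S_k costs inversions.  So inv <= 2 forces S_i = [0,i)
   for i >= 3, and S_1 = {t}, S_2 = {x < y} are found by inspection.

   Many inversions: summing h(i+1,j) - h(i,j) over all i and j, not only over j
   in S_i, telescopes to the sum of the j < n, which is C(n,2).  Hence
   C(n,2) - inv is a sum of nonnegative terms, and it vanishes, or has a single
   term equal to 1, only for final segments S_i, up to one modified set. *)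
Require Import Defs.
From mathcomp Require Import all_boot all_order all_algebra.
From mathcomp Require Import zify.

Set Implicit Arguments.
Unset Strict Implicit.
Unset Printing Implicit Defensive.

Import Order.TTheory GRing.Theory Num.Theory.

(** * Chains of column sets and counting in initial segments *)

Definition cnt (c : nat -> nat -> bool) (i j : nat) : nat := \sum_(k < j) c i k.

(* [c i j] says that column j has partial sum 1 over the first i rows.  The
   magog inequality is only imposed for i, j <= n - 2 on matrices; the remaining
   cases covered by [chain_magog] are automatic. *)
Record magog_chain (n : nat) (c : nat -> nat -> bool) : Prop := MagogChain {
  chain0 : forall j, j < n -> c 0 j = false;
  chain_card : forall i, i <= n -> cnt c i n = i;
  chain_dom : forall i j, i < n -> j <= n -> cnt c i j <= cnt c i.+1 j;
  chain_magog : forall i j, i < n -> j.+2 <= n ->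
    cnt c i j.+1 + c i j <= cnt c i.+1 j.+2 }.

Definition row_inv (n : nat) (c : nat -> nat -> bool) (i : nat) : nat :=
  \sum_(j < n) c i j * (cnt c i.+1 j - cnt c i j).

Definition chain_inv (n : nat) (c : nat -> nat -> bool) : nat :=
  \sum_(i < n) row_inv n c i.

Definition chain_posinv (n : nat) (c : nat -> nat -> bool) : nat :=
  \sum_(i < n) \sum_(j < n) c i j * (cnt c i.+1 j.+1 - cnt c i j.+1).

Section Counting.
Variable c : nat -> nat -> bool.

Lemma cnt0 i : cnt c i 0 = 0.
Proof. exact: big_ord0. Qed.

Lemma cntS i j : cnt c i j.+1 = cnt c i j + c i j.
Proof. exact: big_ord_recr. Qed.

Lemma cnt_le_size i j : cnt c i j <= j.
Proof. by elim: j => [|j IH]; rewrite ?cnt0 ?cntS //; case: (c i j); lia. Qed.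

Lemma cnt_mono i j k : j <= k -> cnt c i j <= cnt c i k.
Proof. by move=> /subnK <-; elim: (k - j) => // m IH; rewrite addSn cntS; lia. Qed.

Lemma cnt_lip i j k : j <= k -> cnt c i k <= cnt c i j + (k - j).
Proof.
move=> le_jk; rewrite -{1}(subnK le_jk); elim: (k - j) => [|m IH]; first by rewrite addn0.
by rewrite addSn cntS; case: (c _ _); lia.
Qed.

Lemma cnt_full i m j : cnt c i m = m -> j <= m -> cnt c i j = j.
Proof. by move=> h jm; have := cnt_lip i jm; have := cnt_le_size i j; lia. Qed.

Lemma mem_full i m j : cnt c i m = m -> j < m -> c i j.
Proof.
move=> h jm; have := cnt_full h jm; rewrite cntS (cnt_full h (ltnW jm)).
by case: (c i j); lia.
Qed.

Lemma eq_cnt c' i j : (forall k, k < j -> c i k = c' i k) -> cnt c i j = cnt c' i j.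
Proof. by move=> e; apply: eq_bigr => k _; rewrite e. Qed.

End Counting.

(** * Encoding of matrices by chains *)

Local Open Scope ring_scope.

(** Only values with [i <= n] and [j < n] are constrained, so chains are compared on that range
    alone. *)
Definition encodes (n : nat) (A : 'M[int]_n) (c : nat -> nat -> bool) : Prop :=
  (forall j, (j < n)%N -> c 0%N j = false) /\
  (forall i j : 'I_n, A i j = (c i.+1 j)%:Z - (c i j)%:Z).

Section Encoding.
Variables (n : nat) (A : 'M[int]_n) (c : nat -> nat -> bool).
Hypothesis cA : encodes A c.

Lemma sum_ord_lt (m : nat) (F : nat -> int) : (m <= n)%N ->
  \sum_(k < n | (k < m)%N) F k = \sum_(k < m) F k.
Proof. by move=> mn; rewrite (big_ord_widen_cond n xpredT F). Qed.

Lemma encodes_col_sum (i : nat) (j : 'I_n) : (i <= n)%N ->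
  \sum_(k < n | (k < i)%N) A k j = (c i j)%:Z.
Proof.
case: cA => c0 eA le_in.
rewrite (eq_bigr (fun k : 'I_n => (c k.+1 j)%:Z - (c k j)%:Z)) //.
rewrite (sum_ord_lt (fun k => (c k.+1 j)%:Z - (c k j)%:Z)) //.
rewrite -(big_mkord xpredT (fun k => (c k.+1 j)%:Z - (c k j)%:Z)).
by rewrite telescope_sumr // c0 // subr0.
Qed.

Lemma encodes_row_sum (i : 'I_n) (j : nat) : (j <= n)%N ->
  \sum_(k < n | (k < j)%N) A i k = (cnt c i.+1 j)%:Z - (cnt c i j)%:Z.
Proof.
case: cA => c0 eA le_jn.
rewrite (eq_bigr (fun k : 'I_n => (c i.+1 k)%:Z - (c i k)%:Z)) //.
rewrite (sum_ord_lt (fun k => (c i.+1 k)%:Z - (c i k)%:Z)) //.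
by rewrite sumrB /cnt !(big_morph Posz PoszD (erefl _)).
Qed.

Lemma encodes_col_psum (i j : 'I_n) : col_psum A i j = (c i.+1 j)%:Z.
Proof. by rewrite -encodes_col_sum. Qed.

Lemma encodes_row_psum (i j : 'I_n) :
  row_psum A i j = (cnt c i.+1 j.+1)%:Z - (cnt c i j.+1)%:Z.
Proof. by rewrite -encodes_row_sum. Qed.

(** The matrix inequality at [i], [j] is the chain inequality at [i.+1], [j]. The other chain cases
    are boundary ones: at index 0 the left side vanishes, at index [n - 1] the next set is
    everything, and for [j.+2 = n] the right side is the size of the next set. *)
Lemma encodes_magog : is_magog A <-> magog_chain n c.
Proof.
have [c0 eA] := cA; split.
  case/and5P => _ /forallP rs _ _ /andP[/forallP rp /forallP mg].
  have row i : (i <= n)%N -> cnt c i n = i.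
    elim: i => [|i IH] lt_in.
      by rewrite /cnt big1 // => k _; rewrite c0.
    have := rs (Ordinal lt_in); rewrite (eq_bigl (fun j : 'I_n => (j < n)%N)).
      by rewrite (encodes_row_sum (Ordinal lt_in) (leqnn n)) /= IH; lia.
    by move=> j; rewrite ltn_ord.
  split=> // i j lt_in.
    case: j => [|j] lt_jn; first by rewrite !cnt0.
    have /forallP/(_ (Ordinal lt_jn)) := rp (Ordinal lt_in).
    by rewrite encodes_row_psum /=; lia.
  move=> lt_jn; have lt0j : (j.+1 <= n)%N by lia.
  case: i lt_in => [|i] lt_in.
    rewrite c0 // {1}/cnt big1 // => k _.
    by rewrite c0 //; have := ltn_ord k; lia.
  have [eq_i|ne_i] := eqVneq i.+2 n.
    have -> : cnt c i.+2 j.+2 = j.+2.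
      by apply: (@cnt_full _ _ n) => //; rewrite eq_i row.
    by have := cnt_le_size c i.+1 j.+1; case: (c _ _); lia.
  have [eq_j|ne_j] := eqVneq j.+2 n.
    rewrite eq_j row //.
    have := cnt_mono c i.+1 lt0j; rewrite row; last by lia.
    by case: (c _ _); lia.
  have /forallP/(_ (Ordinal lt_in)) := mg (Ordinal (ltnW lt_in)).
  move=> /forallP/(_ (Ordinal lt0j)) /forallP/(_ (Ordinal lt_jn)) /=.
  rewrite encodes_row_psum !encodes_col_psum /= !eqxx /= => H.
  have {H} := implyP H; rewrite !cntS; lia.
move=> [_ row dom mg].
have last j : (j < n)%N -> c n j = true.
  by move=> lt_jn; apply: (@mem_full c n n) => //; exact: row.
apply/and5P; split; last (apply/andP; split).
- apply/forallP => i; apply/forallP => j; rewrite eA !inE.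
  by case: (c _ _); case: (c _ _).
- apply/forallP => i; rewrite (eq_bigl (fun j : 'I_n => (j < n)%N)).
    by rewrite encodes_row_sum // !row //; have := ltn_ord i; lia.
  by move=> j; rewrite ltn_ord.
- apply/forallP => j; rewrite (eq_bigl (fun i : 'I_n => (i < n)%N)).
    by rewrite encodes_col_sum // last.
  by move=> i; rewrite ltn_ord.
- apply/forallP => i; apply/forallP => j; rewrite encodes_col_psum.
  by case: (c _ _).
- apply/forallP => i; apply/forallP => j; rewrite encodes_row_psum.
  by have := dom i j.+1 (ltn_ord i) (ltn_ord j); lia.
- apply/forallP => i; apply/forallP => i1; apply/forallP => j; apply/forallP => j1.
apply/implyP => /and4P[/eqP ei /eqP ej lt_i lt_j].
rewrite encodes_row_psum !encodes_col_psum ei ej.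
by have := mg i.+1 j; rewrite !cntS; lia.
Qed.

(** Group the products by the row [i] of the first factor and the column [l] of the second: summing
    over [k < i] gives [c i l], and summing over [j < l] gives a row partial sum, nonnegative by
    dominance, so natural subtraction is exact. *)
Lemma encodes_inv : magog_chain n c -> inv_num A = (chain_inv n c)%:Z.
Proof.
move=> [c0 row dom mg]; rewrite /inv_num /chain_inv.
rewrite (big_morph Posz PoszD (erefl _)); apply: eq_bigr => i _.
rewrite /row_inv (big_morph Posz PoszD (erefl _)) exchange_big /=.
under eq_bigr => j _ do rewrite exchange_big /=.
rewrite (exchange_big_dep xpredT) //=; apply: eq_bigr => l _.
transitivity (\sum_(j < n | (j < l)%N) A i j * (c i l)%:Z).
  apply: eq_bigr => j _; rewrite -mulr_sumr encodes_col_sum //.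
  exact: ltnW.
rewrite -mulr_suml encodes_row_sum; last exact: ltnW.
rewrite PoszM mulrC -subzn //; apply: dom => //; exact: ltnW.
Qed.

Lemma encodes_neg1 :
  num_neg1 A = (\sum_(i < n) \sum_(j < n) (c i j && ~~ c i.+1 j))%N.
Proof.
have [_ eA] := cA.
rewrite /num_neg1 -sum1_card pair_bigA /= big_mkcond /=.
apply: eq_bigr => -[i j] _; rewrite inE /= eA.
by case: (c _ _); case: (c _ _).
Qed.

End Encoding.

(** When [c i j] holds, passing from [j] to [j.+1] lowers the term by one exactly if [c i.+1 j]
    fails, that is, at an entry -1. *)
Lemma chain_inv_posinv n c : magog_chain n c ->
  chain_inv n c = (chain_posinv n c
    + \sum_(i < n) \sum_(j < n) (c i j && ~~ c i.+1 j))%N.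
Proof.
move=> [c0 row dom mg]; rewrite /chain_inv /chain_posinv -big_split /=.
apply: eq_bigr => i _; rewrite /row_inv -big_split /=; apply: eq_bigr => j _.
have := dom i j.+1 (ltn_ord i) (ltn_ord j).
have := dom i j (ltn_ord i) (ltnW (ltn_ord j)).
rewrite !cntS; case: (c i j) => //=; case: (c _ _) => /=; lia.
Qed.

Lemma encodes_posinv n (A : 'M[int]_n) c : encodes A c -> magog_chain n c ->
  posinv_num A = (chain_posinv n c)%:Z.
Proof.
move=> cA ch; rewrite /posinv_num (encodes_inv cA ch) (encodes_neg1 cA).
by rewrite (chain_inv_posinv ch); lia.
Qed.

Lemma bool_diff_sign (b b' : bool) : b%:Z - b'%:Z \in [:: 0; 1; -1].
Proof. by case: b; case: b'. Qed.

Definition chain_mx n (c : nat -> nat -> bool) : 'M[sign_entry]_n :=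
  \matrix_(i, j) SeqSub (bool_diff_sign (c i.+1 j) (c i j)).

Lemma chain_mx_encodes n c : magog_chain n c -> encodes (int_mx (chain_mx n c)) c.
Proof. by move=> [c0 _ _ _]; split=> // i j; rewrite !mxE. Qed.

Lemma int_mx_inj n : injective (@int_mx n).
Proof. by move=> A B /matrixP e; apply/matrixP => i j; have := e i j; rewrite !mxE => /val_inj. Qed.

Lemma magog_encodes n (A : 'M[int]_n) : is_magog A -> exists c, encodes A c.
Proof.
case/and5P => _ _ _ /forallP cp _.
pose S i (j : 'I_n) := \sum_(k < n | (k < i)%N) A k j.
(* Column partial sums are 0 or 1, so testing for 1 loses nothing; [insub] sends columns outside the
   matrix to false. *)
exists (fun i j => if insub j is Some j' then S i j' == 1 else false).
have S01 i j : (i <= n)%N -> S i j = (S i j == 1)%:Z.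
  case: i => [|i] lt_in; first by rewrite /S big1 // => k.
  have /forallP/(_ j) := cp (Ordinal lt_in); rewrite /col_psum -/(S i.+1 j).
  by case: eqVneq => [->//|]; lia.
split=> [j lt_jn|i j].
  by rewrite insubT /= /S big1 // => k.
rewrite !valK -!S01 //; last exact: ltnW.
rewrite /S (bigD1 i) //= (eq_bigl (fun k : 'I_n => (k < i)%N)) ?addrK //.
by move=> k; rewrite ltnS ltn_neqAle andbC.
Qed.

Lemma encodes_chain_mx n (A : 'M[sign_entry]_n) c c' :
  encodes (int_mx A) c -> (forall i j, (i <= n)%N -> (j < n)%N -> c i j = c' i j) ->
  A = chain_mx n c'.
Proof.
move=> [_ eA] e; apply: int_mx_inj; apply/matrixP => i j.
by rewrite eA !mxE /= !e // ltnW.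
Qed.

Lemma chain_mx_inj n c c' : magog_chain n c -> magog_chain n c' ->
  chain_mx n c = chain_mx n c' ->
  forall i j, (i <= n)%N -> (j < n)%N -> c i j = c' i j.
Proof.
move=> ch ch' e i j le_in lt_jn.
have := encodes_col_sum (chain_mx_encodes ch) (Ordinal lt_jn) le_in.
rewrite e (encodes_col_sum (chain_mx_encodes ch') (Ordinal lt_jn) le_in) /=.
by case: (c i j); case: (c' i j).
Qed.

(* Reduction of cardinalities to explicit families of chains *)
Local Close Scope ring_scope.

Lemma card_chain_family n (X : {set 'M[sign_entry]_n}) (Q : (nat -> nat -> bool) -> Prop)
    (T : eqType) (s : seq T) (F : T -> nat -> nat -> bool) :
  (forall A c, encodes (int_mx A) c -> A \in X <-> magog_chain n c /\ Q c) ->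
  (forall A, A \in X -> is_magog (int_mx A)) ->
  uniq s ->
  (forall x, x \in s -> magog_chain n (F x) /\ Q (F x)) ->
  {in s &, forall x y,
     (forall i j, i <= n -> j < n -> F x i j = F y i j) -> x = y} ->
  (forall c, magog_chain n c -> Q c ->
     exists2 x, x \in s & forall i j, i <= n -> j < n -> c i j = F x i j) ->
  #|X| = size s.
Proof.
move=> XP Xm us Fs injF clF.
have -> : #|X| = #|[seq chain_mx n (F x) | x <- s]|.
  apply: eq_card => A; apply/idP/mapP => [AX|[x xs ->]].
    have [c cA] := magog_encodes (Xm _ AX).
    have [ch Qc] := (XP _ _ cA).1 AX.
    have [x xs ex] := clF _ ch Qc; exists x => //.
    exact: encodes_chain_mx cA ex.
  have [ch Qx] := Fs _ xs.
  by apply/(XP _ _ (chain_mx_encodes ch)).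
rewrite (card_uniqP _) ?size_map // map_inj_in_uniq // => x y xs ys e.
by apply: injF => //; apply: chain_mx_inj e; apply Fs.
Qed.

Lemma Magog_invP n k (A : 'M[sign_entry]_n) c : encodes (int_mx A) c ->
  A \in Magog_inv n k <-> magog_chain n c /\ chain_inv n c = k.
Proof.
move=> cA; rewrite inE; split=> [/andP[/(encodes_magog cA) ch]|[ch ek]].
  by rewrite (encodes_inv cA ch) => /eqP[].
by rewrite (encodes_inv cA ch) ek eqxx andbT; apply/(encodes_magog cA).
Qed.

Lemma Magog_posinvP n k (A : 'M[sign_entry]_n) c : encodes (int_mx A) c ->
  A \in Magog_posinv n k <-> magog_chain n c /\ chain_posinv n c = k.
Proof.
move=> cA; rewrite inE; split=> [/andP[/(encodes_magog cA) ch]|[ch ek]].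
  by rewrite (encodes_posinv cA ch) => /eqP[].
by rewrite (encodes_posinv cA ch) ek eqxx andbT; apply/(encodes_magog cA).
Qed.

(** * Few inversions *)

Lemma cnt_eq0 c i n j : cnt c i n = 0 -> j < n -> c i j = false.
Proof.
move=> e lt_jn; have := cnt_mono c i lt_jn; rewrite e cntS.
by case: (c i j); lia.
Qed.

Lemma cnt_last c i n k : cnt c i n = k.+1 ->
  exists y, [/\ y < n, c i y, cnt c i y = k & forall j, y < j < n -> c i j = false].
Proof.
elim: n => [|n IH]; rewrite ?cnt0 ?cntS //.
case cin: (c i n) => e.
  by exists n; split=> //; lia.
have [|y [lt_yn cy ey out]] := IH; first by lia.
exists y; split=> // [|j jn]; first by lia.
by have [->|ne] := eqVneq j n => //; apply: out; lia.
Qed.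

Lemma cnt1P c i n : cnt c i n = 1 ->
  exists2 t, t < n & forall j, j < n -> c i j = (j == t).
Proof.
move=> /cnt_last[t [tn ct e out]]; exists t => // j jn.
case: (ltngtP j t) => [jt|tj|->//]; first exact: cnt_eq0 e jt.
by apply: out; rewrite tj.
Qed.

Lemma cnt2P c i n : cnt c i n = 2 ->
  exists x y, [/\ x < y, y < n & forall j, j < n -> c i j = (j == x) || (j == y)].
Proof.
move=> /cnt_last[y [yn cy /cnt1P[x xy ex] out]]; exists x, y; split=> // j jn.
case: (ltngtP j y) => [jy|yj|->]; last by rewrite orbT.
  by rewrite ex // orbF.
by rewrite orbF out ?yj //; lia.
Qed.

Section SmallInversions.
Variables (n : nat) (c : nat -> nat -> bool).
Hypothesis ch : magog_chain n c.

(** The magog inequality at column [q - 1] counts that last element twice, which gives [q + 1] on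
    the left. *)
Lemma chain_full_succ q : 0 < q < n -> cnt c q q = q -> cnt c q.+1 q.+1 = q.+1.
Proof.
case: q => // q /andP[_ qn] e.
have := chain_magog ch qn (j := q) qn; rewrite e (mem_full e) //.
by have := cnt_le_size c q.+2 q.+2; lia.
Qed.

Lemma chain_full_mem i j : cnt c i i = i -> i <= n -> j < n -> c i j = (j < i).
Proof.
move=> e le_in jn; case: ltnP => [ji|ij]; first by rewrite (mem_full e).
have := cnt_mono c i ij; have := cnt_mono c i jn.
by rewrite cntS (chain_card ch) // e; case: (c i j); lia.
Qed.

(** Here [p] is the least column missing from the [i]-th set. *)
Lemma cnt_gap i m : cnt c i m < m ->
  exists p, [/\ p < m, cnt c i p = p & cnt c i p.+1 = p].
Proof.
elim: m => // m IH lt; have [e|ne] := eqVneq (cnt c i m) m.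
  exists m; split=> //; have := cnt_mono c i (leqnSn m); lia.
have [|p [pm e e']] := IH; first by have := cnt_le_size c i m; lia.
by exists p; split=> //; lia.
Qed.

(** For [j] in the [i]-th set, [cnt c i j] is its rank, so this counts the elements of rank below
    [p]. *)
Lemma sum_cnt_lt i p m : \sum_(j < m) c i j * (cnt c i j < p) = minn p (cnt c i m).
Proof.
elim: m => [|m IH]; first by rewrite big_ord0 cnt0; lia.
by rewrite big_ord_recr /= IH cntS; case: (c i m) => /=; lia.
Qed.

(** Each element [j] of rank between [p] and [p' - 1] costs at least one inversion: as [p] is
    missing, its rank is below [j] as well as below [p'], while the next set has at least
    [minn j p'] elements before [j]. There are [p' - p] such elements. *)
Lemma row_inv_gap i p p' : i < n -> p' <= i -> cnt c i.+1 p' = p' ->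
  cnt c i p = p -> cnt c i p.+1 = p -> p' <= p + row_inv n c i.
Proof.
move=> lt_in p'i e' e1 e2.
have [le_p'|lt_pp'] := leqP p' p; first by lia.
have le_pn : p <= cnt c i n by rewrite (chain_card ch) //; lia.
have := sum_cnt_lt i p n; have := sum_cnt_lt i p' n.
rewrite (minn_idPl le_pn) (minn_idPl _) ?(chain_card ch) // => [<- <-|]; last by lia.
rewrite /row_inv -big_split /=; apply: leq_sum => j _.
case cj: (c i j) => //=; rewrite !mul1n.
case lt_p': (_ < p') => //; case ge_p: (_ < p) => //=.
have ne_jp : j != p :> nat by apply/eqP => ejp; move: cj e2; rewrite ejp cntS => ->; lia.
have lt_pj : p < j by have := cnt_le_size c i j; lia.
have := cnt_lip c i lt_pj; rewrite e2.
have [le_p'j|lt_jp'] := leqP p' j.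
  by have := cnt_mono c i.+1 le_p'j; lia.
by have := cnt_full e' (ltnW lt_jp'); lia.
Qed.

(* The length of the full initial segment [0, p') of the (i+1)-st set of a
   chain costs at least p' inversions, since the k-th set is not [0, k) for 1 <= k <= i. *)
Lemma sum_row_inv_ge i p' : i < n -> cnt c i i < i -> p' <= i ->
  cnt c i.+1 p' = p' -> p' <= \sum_(k < i.+1) row_inv n c k.
Proof.
elim: i p' => // i IH p' lt_in lt_i le_p' e'.
(* By induction the initial segment of length [p] has already cost [p] inversions; row [i.+1] pays
   for the growth from [p] to [p']. *)
have [p [lt_pi e1 e2]] := cnt_gap lt_i.
rewrite big_ord_recr /=; apply: leq_trans (row_inv_gap lt_in le_p' e' e1 e2) _.
rewrite leq_add2r; case: (posnP i) => [i0|i0]; first by lia.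
apply: IH => //; first by lia.
have := cnt_le_size c i i; rewrite leq_eqVlt => /orP[/eqP e|//].
by have := chain_full_succ _ e; lia.
Qed.

(** Downward induction from [n]: if the next set is not an initial segment either, the bound for
    [q.+1] suffices; otherwise the next set contains [[0, q)] and [sum_row_inv_ge] applies with
    [p' = q]. *)
Lemma chain_inv_ge q : q <= n -> cnt c q q < q -> q <= chain_inv n c.
Proof.
move=> /subKn <-; elim: (n - q) => [|m IH] lt_q.
  by move: lt_q; rewrite subn0 (chain_card ch) // ltnn.
have [le_nm|lt_mn] := leqP n m; first by lia.
have eS : (n - m.+1).+1 = n - m by lia.
have := cnt_le_size c (n - m) (n - m); rewrite leq_eqVlt => /orP[/eqP e|/IH]; last by lia.
have lt_n : n - m.+1 < n by lia.
apply: leq_trans (_ : \sum_(k < n - m) row_inv n c k <= _).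
  rewrite -eS; apply: sum_row_inv_ge => //.
  by apply: (@cnt_full _ _ (n - m)); [rewrite eS | lia].
rewrite /chain_inv -!(big_mkord xpredT (row_inv n c)).
by rewrite [leqRHS](big_cat_nat (n := n - m)) //=; lia.
Qed.

Lemma chain_full_of_inv_lt q : 0 < q <= n -> chain_inv n c < q -> cnt c q q = q.
Proof.
move=> /andP[_ qn] lt; have := cnt_le_size c q q.
by rewrite leq_eqVlt => /orP[/eqP//|/(chain_inv_ge qn)]; lia.
Qed.

End SmallInversions.

(** The chain of the identity matrix. *)
Definition id_chain (i j : nat) : bool := j < i.

Lemma sum_bool_ltn m j : \sum_(k < j) (k < m : nat) = minn m j.
Proof.
elim: j => [|j IH]; first by rewrite big_ord0; lia.
by rewrite big_ord_recr /= IH; case: (ltnP j m); lia.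
Qed.

Lemma cnt_id_chain i j : cnt id_chain i j = minn i j.
Proof. exact: sum_bool_ltn. Qed.

Lemma id_chain_magog n : magog_chain n id_chain.
Proof.
split=> [//|i le_in|i j _ _|i j _ _]; rewrite !cnt_id_chain /id_chain; lia.
Qed.

Lemma row_inv_full n c i : i < n ->
  (forall k j, i <= k <= i.+1 -> j < n -> c k j = (j < k)) -> row_inv n c i = 0.
Proof.
move=> lt_in e; rewrite /row_inv big1 // => j _.
rewrite e //; last by lia.
case: ltnP => //= ji; rewrite mul1n.
have E k : i <= k <= i.+1 -> cnt c k j = j.
  move=> ik; rewrite (@eq_cnt c id_chain); first by rewrite cnt_id_chain; lia.
  by move=> l lj; rewrite e //; have := ltn_ord j; lia.
by rewrite !E //; lia.
Qed.

Lemma id_chain_inv n : chain_inv n id_chain = 0.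
Proof. by rewrite /chain_inv big1 // => i _; rewrite row_inv_full. Qed.

Lemma id_chain_posinv n : chain_posinv n id_chain = 0.
Proof. by have := chain_inv_posinv (id_chain_magog n); rewrite id_chain_inv; lia. Qed.

Lemma chain_inv0P n c : magog_chain n c -> chain_inv n c = 0 ->
  forall i j, i <= n -> j < n -> c i j = id_chain i j.
Proof.
move=> ch e [|i] j le_in lt_jn; first by rewrite (chain0 ch).
apply: (chain_full_mem ch) => //; apply: (chain_full_of_inv_lt ch); lia.
Qed.

(** Downward induction on [i]. The largest element [y] of the [i]-th set has a zero term, so the
    next set, [[0, i.+1)] by induction, has at most [i] elements up to [y]. Hence [y < i], and the
    [i]-th set is [[0, i)]. *)
Lemma chain_posinv0P n c : magog_chain n c -> chain_posinv n c = 0 ->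
  forall i j, i <= n -> j < n -> c i j = id_chain i j.
Proof.
move=> ch e.
have full i : i <= n -> cnt c i i = i.
  move=> /subKn <-; elim: (n - i) => [|m IH]; first by rewrite subn0 (chain_card ch).
  have [le_nm|lt_mn] := leqP n m; first by rewrite (_ : n - m.+1 = 0) ?cnt0; lia.
  have eS : (n - m.+1).+1 = n - m by lia.
  have lt_n : n - m.+1 < n by lia.
  move: IH lt_n; rewrite -eS; move: (n - m.+1) => [|k] IH lt_n; first by rewrite cnt0.
  have [y [yn cy ey _]] := cnt_last (chain_card ch (ltnW lt_n)).
  have : c k.+1 y * (cnt c k.+2 y.+1 - cnt c k.+1 y.+1) = 0.
    apply/eqP; rewrite -leqn0 -e /chain_posinv.
    rewrite (bigD1 (Ordinal lt_n)) //= (bigD1 (Ordinal yn)) //=; lia.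
  rewrite cy mul1n; have := chain_dom ch lt_n yn; rewrite [cnt c k.+1 _]cntS ey cy => l1 l2.
  have := cnt_le_size c k.+1 y; rewrite ey => l3.
  have [e'|ne] := eqVneq y k; first by move: ey cy; rewrite e' cntS => -> ->; rewrite addn1.
  have kS : k.+2 <= y.+1 by lia.
  by have := cnt_mono c k.+2 kS; rewrite IH; lia.
by move=> i j le_in lt_jn; apply: (chain_full_mem ch) => //; exact: full.
Qed.

(** By [chain_full_of_inv_lt], a chain with at most two inversions is free only in its first set
    [{t}] and second set [{x < y}]. *)
Definition top3_chain (p : nat * nat * nat) (i j : nat) : bool :=
  let: (t, x, y) := p in
  match i with
  | 1 => j == t
  | 2 => (j == x) || (j == y)
  | _ => j < i
  end.

Lemma sum_bool_eq t m (G : nat -> nat) : t < m -> \sum_(j < m) (j == t :> nat) * G j = G t.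
Proof.
move=> tm; rewrite (bigD1 (Ordinal tm)) //= eqxx mul1n big1 ?addn0 // => j.
by rewrite -val_eqE /= => /negbTE ->.
Qed.

Section Top3.
Variables t x y : nat.
Hypothesis xy : x < y.
Let F := top3_chain (t, x, y).

Lemma cnt_top3 i j : cnt F i j =
  match i with
  | 1 => t < j
  | 2 => (x < j) + (y < j)
  | _ => minn i j
  end.
Proof.
elim: j => [|j IH]; first by rewrite cnt0; case: i => [|[|[|i]]]; lia.
rewrite cntS IH /F /=; case: i {IH} => [|[|[|i]]] //; lia.
Qed.

(** The bound [x <= t] is dominance between the first two sets; [y <= t.+1] is the magog inequality
    at [i = 1], [j = t]. *)
Lemma top3_magog n : 1 < n -> y < n -> t < n -> x <= t -> y <= t.+1 ->
  magog_chain n F.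
Proof.
move=> n1 yn tn xt yt.
split=> [//|i le_in|i j lt_in le_jn|i j lt_in le_jn]; rewrite !cnt_top3.
- by case: i le_in => [|[|[|i]]]; lia.
- by case: i lt_in => [|[|[|i]]]; lia.
by case: i lt_in => [|[|[|i]]] lt_in; rewrite /F /=; lia.
Qed.

Lemma top3_inv n : 1 < n -> y < n -> t < n ->
  chain_inv n F = (x < t) + (y < t) + (minn 3 x + minn 3 y - 1).
Proof.
move=> n1 yn tn.
have r0 : row_inv n F 0 = 0 by rewrite /row_inv big1.
have r1 : row_inv n F 1 = (x < t) + (y < t).
  apply: etrans (sum_bool_eq (fun j => cnt F 2 j - cnt F 1 j) tn) _.
  by rewrite !cnt_top3; lia.
have r2 : row_inv n F 2 = minn 3 x + minn 3 y - 1.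
  rewrite /row_inv (eq_bigr (fun j : 'I_n =>
    (j == x :> nat) * (cnt F 3 j - cnt F 2 j) + (j == y :> nat) * (cnt F 3 j - cnt F 2 j))).
    rewrite big_split /= !(sum_bool_eq (fun j => cnt F 3 j - cnt F 2 j)) //; last by lia.
    by rewrite !cnt_top3; lia.
  by move=> j _; rewrite /F /= -mulnDl; congr (_ * _); lia.
case: n n1 yn tn r0 r1 r2 => [|[|[|n]]] // n1 yn tn r0 r1 r2.
  (* For [n = 2] there is no row 2, but then [x = 0] and [y = 1], so its summand in the formula is
     0. *)
  by rewrite /chain_inv !big_ord_recl big_ord0 /= /bump /= r0 r1; lia.
rewrite /chain_inv !big_ord_recl /= /bump /= r0 r1 r2 big1 ?addn0 // => i _.
apply: row_inv_full => [|k j]; first by have := ltn_ord i; lia.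
by case: k => [|[|[|k]]].
Qed.

End Top3.

Lemma top3_inj n p q : p.1.2 < p.2 < n -> q.1.2 < q.2 < n -> p.1.1 < n -> 1 < n ->
  (forall i j, i <= n -> j < n -> top3_chain p i j = top3_chain q i j) -> p = q.
Proof.
case: p q => [[t x] y] [[t' x'] y'] /= /andP[xy yn] /andP[xy' yn'] tn n1 e.
have et := e 1 t (ltnW n1) tn; have ex := e 2 x n1 (ltn_trans xy yn).
have ex' := e 2 x' n1 (ltn_trans xy' yn').
have ey := e 2 y n1 yn; have ey' := e 2 y' n1 yn'.
by move: et ex ey ex' ey'; rewrite /= !eqxx /= ?orbT => *; do 2?congr pair; lia.
Qed.

Lemma chain_inv_small n c : 1 < n -> magog_chain n c -> chain_inv n c <= 2 ->
  exists t x y, [/\ [&& x < y, y < n, t < n, x <= t & y <= t.+1],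
    forall i j, i <= n -> j < n -> c i j = top3_chain (t, x, y) i j
    & chain_inv n c = (x < t) + (y < t) + (minn 3 x + minn 3 y - 1)].
Proof.
move=> n1 ch le2.
have [t tn et] := cnt1P (chain_card ch (ltnW n1)).
have [x [y [xy yn exy]]] := cnt2P (chain_card ch n1).
have eF i j : i <= n -> j < n -> c i j = top3_chain (t, x, y) i j.
  case: i => [|[|[|i]]] le_in lt_jn; first by rewrite (chain0 ch).
  - exact: et.
  - exact: exy.
  by apply: (chain_full_mem ch) => //; apply: (chain_full_of_inv_lt ch); lia.
have eC i j : i <= n -> j <= n -> cnt c i j = cnt (top3_chain (t, x, y)) i j.
  by move=> le_in le_jn; apply: eq_cnt => k kj; apply: eF => //; lia.
have xt : x <= t.
  by have := chain_dom ch n1 tn; rewrite !eC ?cnt_top3 //=; lia.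
have yt : y <= t.+1.
  have [le|lt] := leqP n t.+1; first by lia.
  by have := chain_magog ch n1 lt; rewrite !eC ?eF ?cnt_top3 //=; lia.
exists t, x, y; split=> //; first by rewrite xy yn tn xt yt.
rewrite -(top3_inv xy n1 yn tn); apply: eq_bigr => i _; apply: eq_bigr => j _.
by rewrite !eC ?eF //; have := ltn_ord j; have := ltn_ord i; lia.
Qed.

(** * Many inversions *)

Section LargeInversions.
Variables (n : nat) (c : nat -> nat -> bool).
Hypothesis ch : magog_chain n c.

Definition inv_defect : nat :=
  \sum_(i < n) \sum_(j < n) ~~ c i j * (cnt c i.+1 j - cnt c i j).

Lemma chain_inv_defect : chain_inv n c + inv_defect = 'C(n, 2).
Proof.
rewrite /chain_inv /inv_defect -big_split /= -bin2_sum big_mkord.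
under eq_bigr => i _ do rewrite -big_split /=.
rewrite exchange_big /=; apply: eq_bigr => j _.
transitivity (\sum_(0 <= i < n) (cnt c i.+1 j - cnt c i j)).
  rewrite big_mkord; apply: eq_bigr => i _.
  by case: (c i j); rewrite /= ?mul0n ?mul1n ?addn0.
have le_jn := ltnW (ltn_ord j).
rewrite (telescope_big (fun k l => cnt c l j - cnt c k j)).
  rewrite (@cnt_full c n n) ?(chain_card ch) // /cnt [X in _ - X]big1.
    by rewrite subn0 ifT //; have := ltn_ord j; lia.
  by move=> k _; rewrite (chain0 ch) //; have := ltn_ord k; lia.
move=> k /andP[_ kn].
(* Telescoping with truncated subtraction needs [cnt c i j] to be nondecreasing in [i]. *)
have mono i : i <= n -> cnt c 0 j <= cnt c i j.
  elim: i => // i IH lt_in; apply: leq_trans (IH (ltnW lt_in)) _; exact: (chain_dom ch).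
by have := mono _ (ltnW kn); rewrite /=; have := chain_dom ch kn le_jn; lia.
Qed.

(** The [i] elements lie in the last [i] columns, hence fill them; a vanishing count at [n - i] is
    how final segments are expressed below. *)
Lemma top_mem i : i <= n -> cnt c i (n - i) = 0 ->
  forall j, j < n -> c i j = (n - i <= j).
Proof.
move=> le_in e j jn; case: leqP => [le|lt]; last exact: cnt_eq0 e lt.
have := cnt_lip c i le; have := cnt_lip c i jn.
by rewrite e (chain_card ch) // cntS; case: (c i j); lia.
Qed.

(** For a chain, this says that row [i] contributes nothing to [inv_defect]. *)
Definition good_row i := forall j, j < n -> c i j = false -> cnt c i.+1 j = cnt c i j.

(** Column [n - i.+1] lies outside the [i]-th set, so the count before it stays 0. *)
Lemma top_step i : i < n -> good_row i -> cnt c i (n - i) = 0 ->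
  cnt c i.+1 (n - i.+1) = 0.
Proof.
move=> lt_in good e; have lt : n - i.+1 < n - i by lia.
rewrite good ?(cnt_eq0 e) //; last by lia.
by have := cnt_mono c i (ltnW lt); lia.
Qed.

Lemma top_steps a b : a <= b <= n -> (forall i, a <= i < b -> good_row i) ->
  cnt c a (n - a) = 0 -> cnt c b (n - b) = 0.
Proof.
move=> /andP[/subnK <-]; elim: (b - a) => [|m IH] // le good e.
rewrite addSn; apply: top_step; [lia | apply: good; lia |].
by apply: IH => // [|i ai]; [lia | apply: good; lia].
Qed.

Lemma cnt_block i a b : a <= b -> (forall j, a <= j < b -> c i j) ->
  cnt c i b = cnt c i a + (b - a).
Proof.
move=> /subnK <-; elim: (b - a) => [|m IH] cj; first by rewrite add0n; lia.
by rewrite addSn cntS cj ?IH; [lia | move=> j aj; apply: cj; lia | lia].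
Qed.

Lemma inv_defect0 : inv_defect = 0 -> forall i, i < n -> good_row i.
Proof.
move=> /eqP; rewrite sum_nat_eq0 => /forallP H i lt_in j lt_jn cj.
have := H (Ordinal lt_in); rewrite sum_nat_eq0 => /forallP/(_ (Ordinal lt_jn)).
by have := chain_dom ch lt_in (ltnW lt_jn); rewrite /= cj /=; lia.
Qed.

End LargeInversions.

(* The sets are the final segments [n - i, n), except that for i = q the
   smallest element is lowered by one; for q > n there is no exception. *)
Definition rev_chain (n q i j : nat) : bool :=
  if i == q then (j == n - q.+1) || (n - q < j) else n - i <= j.

Lemma sum_bool_leq m n : \sum_(j < n) (m <= j : nat) = n - m.
Proof.
elim: n => [|n IH]; first by rewrite big_ord0.
by rewrite big_ord_recr /= IH; lia.
Qed.

Section RevChain.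
Variables n q : nat.
Hypotheses (q0 : 0 < q) (qn : q != n).

Lemma cnt_rev_chain i j : i <= n ->
  cnt (rev_chain n q) i j =
  if i == q then (n - q.+1 < j) + (j - (n - q).+1) else j - (n - i).
Proof.
move=> le_in; elim: j => [|j IH]; first by rewrite cnt0; case: eqP.
by rewrite cntS IH /rev_chain; case: eqVneq => [eiq|_]; lia.
Qed.

Lemma rev_chain_magog : magog_chain n (rev_chain n q).
Proof.
split=> [j jn|i le_in|i j lt_in le_jn|i j lt_in le_jn].
- by rewrite /rev_chain; case: eqP; lia.
- by rewrite cnt_rev_chain //; case: eqP; lia.
- rewrite !cnt_rev_chain //; last exact: ltnW.
  by case: (i =P q); case: (i.+1 =P q); lia.
rewrite !cnt_rev_chain /rev_chain //; last exact: ltnW.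
by case: (i =P q); case: (i.+1 =P q); lia.
Qed.

(** In the sets of index below [n], every element contributes one, except the lowered element of the
    [q]-th set, which contributes nothing. *)
Lemma rev_chain_posinv : chain_posinv n (rev_chain n q) = 'C(n, 2) - (q < n).
Proof.
rewrite /chain_posinv (eq_bigr (fun i : 'I_n => i - (i == q :> nat))).
  have -> : 'C(n, 2) = \sum_(i < n) (i - (i == q :> nat)) + \sum_(i < n) (i == q :> nat).
    rewrite -bin2_sum big_mkord -big_split /=; apply: eq_bigr => i _.
    by case: eqP; lia.
  have [lt_qn|le_nq] := ltnP q n.
    have := sum_bool_eq (fun=> 1) lt_qn.
    by rewrite /=; under eq_bigr => i _ do rewrite muln1; move=> ->; lia.
  rewrite [X in _ = _ + X - _]big1 => [|i _]; first by rewrite addn0 subn0.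
  by have := ltn_ord i; case: eqP; lia.
move=> i _; have lt_in := ltn_ord i.
rewrite (eq_bigr (fun j : 'I_n => (n - i + (i == q :> nat) <= j : nat))).
  by rewrite sum_bool_leq; case: eqP; lia.
move=> j _; have lt_jn := ltn_ord j.
rewrite !cnt_rev_chain //; last exact: ltnW.
rewrite /rev_chain.
by case: (i =P q :> nat); case: (i.+1 =P q); case: leqP; lia.
Qed.

End RevChain.

Lemma posinv_le_inv n c : magog_chain n c -> chain_posinv n c <= chain_inv n c.
Proof. by move=> /chain_inv_posinv ->; lia. Qed.

(** This is the chain of the antidiagonal matrix; its [inv] lies between its [posinv] and
    ['C(n, 2)], which coincide. *)
Lemma rev_chain_inv n : chain_inv n (rev_chain n n.+1) = 'C(n, 2).
Proof.
have ch : magog_chain n (rev_chain n n.+1) by apply: rev_chain_magog => //; lia.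
have := chain_inv_defect ch; have := posinv_le_inv ch.
by rewrite rev_chain_posinv //; lia.
Qed.

Lemma chain_inv_max n c : magog_chain n c -> chain_inv n c = 'C(n, 2) ->
  forall i j, i <= n -> j < n -> c i j = rev_chain n n.+1 i j.
Proof.
move=> ch e i j le_in lt_jn; have d0 : inv_defect n c = 0.
  by have := chain_inv_defect ch; lia.
rewrite /rev_chain (_ : i == n.+1 = false); last by lia.
apply: (top_mem ch) => //; apply: (@top_steps _ _ 0) => //.
  by move=> k /andP[_ ki]; apply: (inv_defect0 ch d0); lia.
by rewrite subn0 (chain_card ch).
Qed.

Lemma eq_chain_posinv n c c' :
  (forall i j, i <= n -> j < n -> c i j = c' i j) -> chain_posinv n c = chain_posinv n c'.
Proof.
move=> e; apply: eq_bigr => i _; apply: eq_bigr => j _.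
have eC k : k <= n -> cnt c k j.+1 = cnt c' k j.+1.
  by move=> kn; apply: eq_cnt => l lj; apply: e => //; have := ltn_ord j; lia.
by rewrite !eC ?e //; exact: ltnW.
Qed.

(** The number of entries -1 and the defect add up to 1. Zero defect would force the antidiagonal
    chain, whose [posinv] is too large; so the defect is 1 and the sets increase. *)
Lemma chain_posinv_submax n c : magog_chain n c ->
  (chain_posinv n c).+1 = 'C(n, 2) ->
  exists2 q, 0 < q < n & forall i j, i <= n -> j < n -> c i j = rev_chain n q i j.
Proof.
move=> ch e; have eN := chain_inv_posinv ch; have eD := chain_inv_defect ch.
have neD : inv_defect n c != 0.
  apply/eqP => d0; have := eq_chain_posinv (chain_inv_max ch _).
  by rewrite rev_chain_posinv //; lia.
have eN0 : \sum_(i < n) \sum_(j < n) (c i j && ~~ c i.+1 j) = 0 by lia.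
have sub i j : i < n -> j < n -> c i j -> c i.+1 j.
  move=> lt_in lt_jn cij; move/eqP: eN0; rewrite sum_nat_eq0.
  move=> /forallP/(_ (Ordinal lt_in)); rewrite sum_nat_eq0.
  by move=> /forallP/(_ (Ordinal lt_jn)); rewrite /= cij; case: (c _ _).
have /eqP : inv_defect n c = 1 by lia.
(* The defect sits at a single position [(i0, j0)]; the exceptional set will be the one of index
   [i0.+1]. *)
rewrite /inv_defect pair_bigA => /sum_nat_eq1 [[i0 j0] [_ /= e1 e0]].
have good i j : i < n -> j < n -> (i != i0) || (j != j0) -> c i j = false ->
    cnt c i.+1 j = cnt c i j.
  move=> lt_in lt_jn ne cij.
  have := e0 (Ordinal lt_in, Ordinal lt_jn); rewrite /= cij xpair_eqE negb_and.
  move=> /(_ ne isT); have := chain_dom ch lt_in (ltnW lt_jn); lia.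
have lt_i0 := ltn_ord i0; have lt_j0 := ltn_ord j0.
have top_le i : i <= i0 -> cnt c i (n - i) = 0.
  move=> le_i; apply: (@top_steps _ _ 0); first by lia.
    by move=> k /andP[_ ki] j lt_jn cj; apply: good => //; lia.
  by rewrite subn0 (chain_card ch).
have top0 j : j <= n - i0 -> cnt c i0 j = 0.
  by move=> le; have := cnt_mono c i0 le; rewrite top_le //; lia.
have cj0 : c i0 j0 = false by move: e1; case: (c _ _).
have le_j0 : j0 < n - i0.
  by rewrite ltnNge -(top_mem ch _ (top_le _ (leqnn _))) ?cj0 //; exact: ltnW.
have h0 j : j < n - i0 -> j != j0 -> cnt c i0.+1 j = 0.
  move=> lt ne; rewrite good ?ne ?orbT //; [exact/top0/ltnW | lia |].
  exact: cnt_eq0 (top_le _ (leqnn _)) lt.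
have h1 : cnt c i0.+1 j0 = 1.
  by move: e1; rewrite cj0 mul1n top0 ?subn0 //; exact: ltnW.
(* Were [j0] smaller, the count before [j0.+1] would be 0, yet it is at least the count 1 before
   [j0]. *)
have ej0 : j0 = n - i0.+1 :> nat.
  have [lt|ge] := ltnP j0 (n - i0.+1); last by lia.
  have : cnt c i0.+1 j0.+1 = 0 by apply: h0; lia.
  by rewrite cntS h1.
have j00 : 0 < j0 by case: (val j0) h1; rewrite ?cnt0.
have lt_q : i0.+1 < n by lia.
have cq_low : c i0.+1 j0.-1.
  have := h1; rewrite -{1}(prednK j00) cntS h0; [|lia|lia].
  by case: (c _ _).
have cq_high j : j0 < j < n -> c i0.+1 j.
  move=> /andP[lt jn]; apply: sub => //.
  by rewrite (top_mem ch _ (top_le _ (leqnn _))) //; lia.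
(* One element lies below [j0] and [i0] above, which exhausts the [i0.+1] elements. *)
have cq_mid : c i0.+1 j0 = false.
  have := cnt_block lt_j0 cq_high.
  by rewrite (chain_card ch) // cntS h1; case: (c _ _); lia.
(* Row [i0.+1] has no defect and keeps [j0.-1], the only element below [j0]; so the next set is a
   final segment again. *)
have top_q : cnt c i0.+2 (n - i0.+2) = 0.
  have : cnt c i0.+2 j0 = 1 by rewrite good //; lia.
  rewrite -{1}(prednK j00) cntS sub //; last by lia.
  by rewrite (_ : j0.-1 = n - i0.+2); lia.
have top_ge i : i0.+2 <= i <= n -> cnt c i (n - i) = 0.
  move=> le_i; apply: (top_steps le_i _ top_q).
  by move=> k ki j lt_jn cj; apply: good => //; lia.
exists i0.+1 => // i j le_in lt_jn; rewrite /rev_chain.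
case: eqVneq => [->|ne].
  case: (ltngtP j j0) => [lt|gt|ej].
  - have [->|ne'] := eqVneq j j0.-1; first by rewrite cq_low; lia.
    have -> : c i0.+1 j = false.
      by apply: (@cnt_eq0 _ _ j0.-1); [apply: h0; lia | lia].
    by lia.
  - by rewrite cq_high ?gt //; lia.
  by rewrite ej cq_mid; lia.
apply: (top_mem ch) => //.
by have [le|gt] := leqP i i0; [exact: top_le | apply: top_ge; lia].
Qed.

(** Column [n - q] is missing from the [q]-th set only if [q] is the exceptional index. *)
Lemma rev_chain_inj n q q' : 0 < q < n ->
  (forall i j, i <= n -> j < n -> rev_chain n q i j = rev_chain n q' i j) -> q = q'.
Proof.
move=> qn e; have : rev_chain n q q (n - q) = rev_chain n q' q (n - q) by apply: e; lia.
by rewrite /rev_chain eqxx; case: (q =P q') => // _; lia.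
Qed.

(** * The seven cardinalities *)

Lemma card_Magog_inv n k (T : eqType) (s : seq T) (F : T -> nat -> nat -> bool) :
  uniq s ->
  (forall x, x \in s -> magog_chain n (F x) /\ chain_inv n (F x) = k) ->
  {in s &, forall x y,
     (forall i j, i <= n -> j < n -> F x i j = F y i j) -> x = y} ->
  (forall c, magog_chain n c -> chain_inv n c = k ->
     exists2 x, x \in s & forall i j, i <= n -> j < n -> c i j = F x i j) ->
  #|Magog_inv n k| = size s.
Proof.
apply: (@card_chain_family n _ (fun c => chain_inv n c = k)).
  by move=> A c; exact: Magog_invP.
by move=> A; rewrite inE => /andP[].
Qed.

Lemma card_Magog_posinv n k (T : eqType) (s : seq T) (F : T -> nat -> nat -> bool) :
  uniq s ->
  (forall x, x \in s -> magog_chain n (F x) /\ chain_posinv n (F x) = k) ->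
  {in s &, forall x y,
     (forall i j, i <= n -> j < n -> F x i j = F y i j) -> x = y} ->
  (forall c, magog_chain n c -> chain_posinv n c = k ->
     exists2 x, x \in s & forall i j, i <= n -> j < n -> c i j = F x i j) ->
  #|Magog_posinv n k| = size s.
Proof.
apply: (@card_chain_family n _ (fun c => chain_posinv n c = k)).
  by move=> A c; exact: Magog_posinvP.
by move=> A; rewrite inE => /andP[].
Qed.

Theorem theorem3p21 :
  [/\ (forall n : nat, (1 <= n)%N ->
         #|Magog_inv n 0| = 1%N /\ #|Magog_posinv n 0| = 1%N),
      (forall n : nat, (2 <= n)%N -> #|Magog_inv n 1| = 1%N),
      (forall n : nat, (2 <= n)%N ->
         #|Magog_posinv n ('C(n, 2) - 1)| = (n - 1)%N),
      (forall n : nat, (2 <= n)%N ->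
         #|Magog_inv n 'C(n, 2)| = 1%N /\ #|Magog_posinv n 'C(n, 2)| = 1%N)
    & (forall n : nat, (3 <= n)%N -> #|Magog_inv n 2| = (n + 1)%N)].
Proof.
split=> n le_n.
- split.
    apply: (@card_Magog_inv _ _ _ [:: tt] (fun=> id_chain)) => // [_ _|[] []|c ch e] //.
      by split; [exact: id_chain_magog | exact: id_chain_inv].
    by exists tt; rewrite ?inE //; exact: chain_inv0P.
  apply: (@card_Magog_posinv _ _ _ [:: tt] (fun=> id_chain)) => // [_ _|[] []|c ch e] //.
    by split; [exact: id_chain_magog | exact: id_chain_posinv].
  by exists tt; rewrite ?inE //; exact: chain_posinv0P.
(* The triple [(1, 0, 1)] is the identity matrix with its first two rows exchanged. *)
- apply: (@card_Magog_inv _ _ _ [:: (1, 0, 1)] top3_chain) => // [x|x y|c ch e].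
  + by rewrite inE => /eqP ->; rewrite top3_inv //; split=> //; exact: top3_magog.
  + by rewrite !inE => /eqP -> /eqP ->.
  have [|t [x [y [B eF eW]]]] := chain_inv_small le_n ch; first by rewrite e.
  exists (1, 0, 1); first by rewrite inE.
  by move: eF; have [-> -> ->] : [/\ t = 1, x = 0 & y = 1] by split; lia.
(* Positivity makes the truncated ['C(n, 2) - 1] a genuine predecessor. *)
- have C1 : 0 < 'C(n, 2) by rewrite bin_gt0.
  rewrite -[RHS](size_iota 1).
  apply: (@card_Magog_posinv _ _ _ _ (rev_chain n)) => [|q|q q'|c ch e].
  + exact: iota_uniq.
  + rewrite mem_iota => qn; split; first by apply: rev_chain_magog; lia.
    by rewrite rev_chain_posinv; [congr (_ - _); lia | lia | lia].
  + by rewrite !mem_iota => qn _; apply: rev_chain_inj; lia.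
  have [|q qn eF] := chain_posinv_submax ch; first by lia.
  by exists q => //; rewrite mem_iota; lia.
- have rc : magog_chain n (rev_chain n n.+1) by apply: rev_chain_magog => //; lia.
  split.
    apply: (@card_Magog_inv _ _ _ [:: tt] (fun=> rev_chain n n.+1)) => // [_ _|[] []|c ch e] //.
      by split=> //; exact: rev_chain_inv.
    by exists tt; rewrite ?inE //; exact: chain_inv_max.
  apply: (@card_Magog_posinv _ _ _ [:: tt] (fun=> rev_chain n n.+1)) => // [_ _|[] []|c ch e] //.
    by split=> //; rewrite rev_chain_posinv //; lia.
  exists tt; rewrite ?inE //; apply: chain_inv_max => //.
  by have := posinv_le_inv ch; have := chain_inv_defect ch; lia.
(* Solutions [(t, x, y)] with weight 2: for [{x, y} = {0, 1}] row 1 must cost 2, so [t >= 2]; for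
   [{0, 2}] rows 1 and 2 cost 1 each, so [t] is 1 or 2; for [{1, 2}] row 2 costs 2, so [t = 1]. *)
pose s := [:: (1, 0, 2); (2, 0, 2); (1, 1, 2)] ++ [seq (t, 0, 1) | t <- iota 2 (n - 2)].
have -> : n + 1 = size s by rewrite size_cat size_map size_iota /=; lia.
have sP p : p \in s -> [&& p.1.2 < p.2, p.2 < n, p.1.1 < n, p.1.2 <= p.1.1, p.2 <= p.1.1.+1 &
    (p.1.2 < p.1.1) + (p.2 < p.1.1) + (minn 3 p.1.2 + minn 3 p.2 - 1) == 2].
  rewrite mem_cat !inE => /orP[/or3P[] /eqP -> /=|/mapP[t]]; try lia.
  by rewrite mem_iota => tn -> /=; lia.
apply: (@card_Magog_inv _ _ _ _ top3_chain) => [|p /sP|p q /sP ps /sP qs|c ch e].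
- rewrite cat_uniq map_inj_uniq ?iota_uniq ?andbT => [|t t' [//]].
  by apply/andP; split=> //; apply/hasPn => p /mapP[t _ ->]; rewrite !inE !xpair_eqE !andbF.
- case: p => [[t x] y] /= ps; split; first by apply: top3_magog; lia.
  by rewrite top3_inv; lia.
- by case: p q ps qs => [[t x] y] [[t' x'] y'] ps qs e;
  apply: top3_inj e; move: ps qs => /=; lia.
have [||t [x [y [B eF eW]]]] := chain_inv_small _ ch; [lia | by rewrite e |].
exists (t, x, y) => //; rewrite mem_cat !inE.
have [ex|/eqP nx] := x =P 0; have [ey|ny] := eqVneq y 1.
- apply/orP; right; apply/mapP; exists t; last by rewrite ex ey.
  by rewrite mem_iota; lia.
- apply/orP; left; rewrite !xpair_eqE; lia.
- by lia.
- apply/orP; left; rewrite !xpair_eqE; lia.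
Qed.
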